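(* Let $\mathcal{T}$ be a (stationary, finite) $k$-spacetree, $k\ge 2$, whose root is a square/cube in $\mathbb{R}^d$, $d\in\{2,3\}$, and let $\mathbb{M}$ be a set of particles with positions $x(m)\in\mathbb{R}^d$ and flags $moved(m)\in\{\top,\bot\}$. Initially every particle is assigned to a vertex of the spacetree whose dual cell covers its position. Run tree traversals, one after another, whose events $\mathrm{touchVertexFirstTime}$, $\mathrm{enterCell}$, $\mathrm{leaveCell}$ and $\mathrm{touchVertexLastTime}$ are ordered as described in the context and perform the operations of the particle-in-dual-tree (PIDT) algorithm given in the context. Then, whenever $\mathrm{touchVertexFirstTime}$ is invoked on a vertex $v$ and all its preamble operations have terminated, all particles within the dual cell of $v$ (i.e. all particles assigned to $v$ at that moment) have a position covered by this dual cell.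
   Context: **Spacetree.** The root is a $d$-dimensional square/cube spanning the whole computational domain. A cell is refined by cutting it into $k$ equal parts along each coordinate axis, yielding $k^d$ child squares/cubes that tessellate it. For each cell one decides whether to refine further. The resulting set of cells is $\mathcal{T}$; write $a\sqsubseteq_{child\ of} b$ if $a$ is one of the $k^d$ children of $b$ ($b$ is the parent of $a$). A cell without children is a leaf (unrefined); otherwise it is refined. The level of a cell is its distance from the root in the tree; all cells of one level have the same size. **Vertices and dual cells.** The vertices of level $\ell$ are the corners of the cells of level $\ell$; vertices at the same location but on different levels are distinct. A vertex of level $\ell$ is adjacent to those (up to $2^d$) cells of level $\ell$ that have it as a corner. A vertex is refined if all its surrounding (adjacent) cells are refined. A vertex $v_b$ is a parent of $v_a$ if all cells adjacent to $v_a$ have parent cells that are adjacent to $v_b$; a vertex has up to $2^d$ parents. The dual cell of a vertex $v$ of level $\ell$ is the axis-aligned square/cube centred at $v$ of the same size as the cells of level $\ell$. A cell or dual cell covers (contains, holds) a position $x$ if $x$ lies in the square/cube. **Order of events.** In each traversal every cell $c$ receives one $\mathrm{enterCell}(c)$ and one $\mathrm{leaveCell}(c)$, and every vertex $v$ one $\mathrm{touchVertexFirstTime}(v)$ and one $\mathrm{touchVertexLastTime}(v)$. If $a\sqsubseteq_{child\ of} b$, then $\mathrm{enterCell}(b)$ is before $\mathrm{enterCell}(a)$ and $\mathrm{leaveCell}(a)$ is before $\mathrm{leaveCell}(b)$; for every $c$, $\mathrm{enterCell}(c)$ is before $\mathrm{leaveCell}(c)$. $\mathrm{touchVertexFirstTime}(v)$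 is called before the vertex is used for the very first time in the traversal, i.e. before $\mathrm{enterCell}$ is invoked on any cell adjacent to $v$. $\mathrm{touchVertexLastTime}(v)$ is called after the vertex has been used for the very last time, i.e. after $\mathrm{leaveCell}$ has been invoked on all cells adjacent to $v$. $\mathrm{touchVertexLastTime}$ is called bottom-up throughout the traversal. **PIDT algorithm.** At any time each particle $m$ is assigned to (associated with) exactly one vertex. $\mathrm{touchVertexFirstTime}(v)$: 1. (Preamble) If $v$ is refined: for every $m$ assigned to $v$, set $moved(m)\gets\bot$. 2. Invoke application-specific operations. $\mathrm{enterCell}(c)$: 1. (Preamble) If $c$ is refined: for each of the $2^d$ vertices $v$ adjacent to $c$ and every $m$ assigned to $v$, if $moved(m)=\bot$ and $x(m)$ is contained in $c$, identify the child vertex $v'$ (a vertex of a child of $c$) whose dual cell holds $x(m)$ and assign $m$ to $v'$ (drop). 2. Invoke application-specific operations. 3. If $c$ is unrefined: for each of the $2^d$ adjacent vertices $v$ and every $m$ assigned to $v$, if $moved(m)=\bot$ and $x(m)$ is contained in $c$, update the position $x(m)$ (move) and set $moved(m)\gets\top$. 4. Invoke application-specific operations. $\mathrm{leaveCell}(c)$: 1. Invoke application-specific operations. 2. (Epilogue) For each of the $2^d$ adjacent vertices $v$ and every $m$ assigned to $v$: if $moved(m)=\top$ and $x(m)$ is contained in the dual cell of another vertex $v'$ adjacent to $c$, assign $m$ to $v'$. $\mathrm{touchVertexLastTime}(v)$: 1. Invoke application-specific operations. 2. (Epilogue) For every $m$ assigned to $v$: if $moved(m)=\top$ and $x(m)$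 is not contained in the dual cell of $v$, assign $m$ to a parent vertex of $v$ (lift). The new position in a move is not subject to any bound on the distance travelled; particles stay within the computational domain, which is spanned by the root cell.
   Formalization: The bottom-up order is taken to include that touchVertexLastTime of every vertex below the root level precedes leaveCell of the root cell; without this a late lift can leave a particle on a wrong root vertex and the claim fails. *)

(* Defs.v *)
From HB Require Import structures.
From mathcomp Require Import all_boot all_order all_algebra.
From mathcomp Require Import finmap.
From mathcomp Require Import reals.

Set Implicit Arguments.
Unset Strict Implicit.
Unset Printing Implicit Defensive.

Import Order.TTheory GRing.Theory Num.Theory.

Local Open Scope ring_scope.

(* Cells and vertices are pairs (level, integer coordinates).  If the root is
   o + [0, h]^d, level l is a lattice of mesh size h / k ^ l; the cell (l, i) is
   the cube of that size with lower corner o + (h / k ^ l) i, and the vertex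
   (l, j) is the point o + (h / k ^ l) j.  Vertices at the same location but on
   different levels are thus distinct. *)
Definition cell (d : nat) : Type := (nat * {ffun 'I_d -> nat})%type.
Definition vertex (d : nat) : Type := (nat * {ffun 'I_d -> nat})%type.


Definition root_cell (d : nat) : cell d := (0%N, [ffun=> 0%N]).

Definition child_of (d k : nat) (a b : cell d) : bool :=
  (a.1 == b.1.+1) &&
  [forall i, (k * b.2 i <= a.2 i)%N && (a.2 i < k * b.2 i + k)%N].

Definition spacetree (d k : nat) (T : {fset cell d}) : Prop :=
  [/\ root_cell d \in T,
      forall a, a \in T ->
        a = root_cell d \/ exists2 b, b \in T & child_of k a b
    & forall a a' b, a \in T -> b \in T ->
        child_of k a b -> child_of k a' b -> a' \in T].

Definition corners (d : nat) (c : cell d) : seq (vertex d) :=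
  [seq (c.1, [ffun i => (c.2 i + e i)%N]) | e : {ffun 'I_d -> bool}].

Section Spacetree.
Context (d k : nat) (T : {fset cell d}).

Definition vertices : seq (vertex d) :=
  undup (flatten [seq corners c | c <- T]).

Definition refined (c : cell d) : bool := has (fun a => child_of k a c) T.

Definition vrefined (v : vertex d) : bool :=
  all (fun c => (v \in corners c) ==> refined c) T.

Definition child_vertex (v : vertex d) (c : cell d) : bool :=
  has (fun a => child_of k a c && (v \in corners a)) T.

Definition vparent (vb va : vertex d) : bool :=
  all (fun a => (va \in corners a) ==>
         has (fun b => child_of k a b && (vb \in corners b)) T) T.

Definition parents (v : vertex d) : seq (vertex d) :=
  [seq vb <- vertices | vparent vb v].

End Spacetree.

Inductive event (d : nat) : Type :=
| TouchFirst of vertex d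
| EnterCell of cell d
| LeaveCell of cell d
| TouchLast of vertex d.

Definition event_code d (e : event d) : 'I_4 * (nat * {ffun 'I_d -> nat}) :=
  match e with
  | TouchFirst v => (inord 0, v)
  | EnterCell c => (inord 1, c)
  | LeaveCell c => (inord 2, c)
  | TouchLast v => (inord 3, v)
  end.

Definition event_decode d (p : 'I_4 * (nat * {ffun 'I_d -> nat})) : event d :=
  match val p.1 with
  | 0 => TouchFirst p.2
  | 1 => EnterCell p.2
  | 2 => LeaveCell p.2
  | _ => TouchLast p.2
  end.

Lemma event_codeK d : cancel (@event_code d) (@event_decode d).
Proof. by case=> x; rewrite /event_decode /= inordK. Qed.

HB.instance Definition _ d := Equality.copy (event d) (can_type (@event_codeK d)).

Definition is_event (d : nat) (T : {fset cell d}) (e : event d) : bool :=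
  match e with
  | TouchFirst v | TouchLast v => v \in vertices T
  | EnterCell c | LeaveCell c => c \in T
  end.

Definition before (d : nat) (t : seq (event d)) (e1 e2 : event d) : Prop :=
  (index e1 t < index e2 t)%N.

(* "touchVertexLastTime is called bottom-up throughout the traversal" is the
   conjunction of the last two fields.  The last one does not follow from the
   others: it says that the sweep has completed every level below the root when
   the root cell, on which all lifts end, is left. *)
Record traversal (d k : nat) (T : {fset cell d}) (t : seq (event d)) : Prop :=
  Traversal {
    each_once : forall e, count_mem e t = is_event T e;
    enter_top_down : forall a b, a \in T -> b \in T -> child_of k a b ->
      before t (EnterCell b) (EnterCell a);
    leave_bottom_up : forall a b, a \in T -> b \in T -> child_of k a b ->
      before t (LeaveCell a) (LeaveCell b);
    enter_leave : forall c, c \in T -> before t (EnterCell c) (LeaveCell c);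
    touch_enter : forall c v, c \in T -> v \in corners c ->
      before t (TouchFirst v) (EnterCell c);
    leave_touch : forall c v, c \in T -> v \in corners c ->
      before t (LeaveCell c) (TouchLast v);
    touch_last_bottom_up : forall va vb, va \in vertices T ->
      vb \in parents k T va -> before t (TouchLast va) (TouchLast vb);
    touch_last_root : forall v, v \in vertices T -> (0 < v.1)%N ->
      before t (TouchLast v) (LeaveCell (root_cell d))
  }.

(* Particle states.  Every particle is assigned to exactly one vertex. *)
Record state (R : realType) (d : nat) (M : Type) := State {
  assigned : M -> vertex d;
  pos : M -> 'rV[R]_d;
  moved : M -> bool
}.

(* A for-loop over the sequence vs whose body is nondeterministic. *)
Fixpoint loop {I S : Type} (body : I -> S -> S -> Prop) (vs : seq I)
    (s s' : S) : Prop :=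
  if vs is v :: vs' then exists2 s1, body v s s1 & loop body vs' s1 s'
  else s' = s.

Section PIDT.
Context (R : realType) (d k : nat) (o : 'rV[R]_d) (h : R).
Context (T : {fset cell d}) (M : Type).
Implicit Types (c : cell d) (v : vertex d) (x : 'rV[R]_d).
Implicit Types (s : state R d M).

Definition mesh (l : nat) : R := h / k%:R ^+ l.

Definition in_cell c x : bool :=
  [forall i, (o 0 i + (c.2 i)%:R * mesh c.1 <= x 0 i) &&
             (x 0 i <= o 0 i + (c.2 i).+1%:R * mesh c.1)].

Definition in_dual v x : bool :=
  [forall i, `|x 0 i - (o 0 i + (v.2 i)%:R * mesh v.1)| <= mesh v.1 / 2].

Definition in_domain x : bool := in_cell (root_cell d) x.

Definition touch_first v (s s' : state R d M) : Prop := forall m,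
  [/\ assigned s' m = assigned s m,
      pos s' m = pos s m
    & moved s' m =
        if (assigned s m == v) && vrefined k T v then false else moved s m].

Definition drop c v (s s' : state R d M) : Prop := forall m,
  [/\ if [&& assigned s m == v, ~~ moved s m & in_cell c (pos s m)]
      then child_vertex k T (assigned s' m) c /\
           in_dual (assigned s' m) (pos s m)
      else assigned s' m = assigned s m,
      pos s' m = pos s m
    & moved s' m = moved s m].

Definition move c v (s s' : state R d M) : Prop := forall m,
  assigned s' m = assigned s m /\
  if [&& assigned s m == v, ~~ moved s m & in_cell c (pos s m)]
  then in_domain (pos s' m) /\ moved s' m = true
  else pos s' m = pos s m /\ moved s' m = moved s m.

Definition reassign c v (s s' : state R d M) : Prop := forall m,
  let new v' := (v' != v) && in_dual v' (pos s m) in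
  [/\ if [&& assigned s m == v, moved s m & has new (corners c)]
      then assigned s' m \in corners c /\ new (assigned s' m)
      else assigned s' m = assigned s m,
      pos s' m = pos s m
    & moved s' m = moved s m].

(* A particle on a vertex without parents (level 0) cannot be lifted: it keeps
   its vertex even if its position has left the dual cell. *)
Definition lift v (s s' : state R d M) : Prop := forall m,
  [/\ if [&& assigned s m == v, moved s m, ~~ in_dual v (pos s m)
           & parents k T v != [::]]
      then is_true (assigned s' m \in parents k T v)
      else assigned s' m = assigned s m,
      pos s' m = pos s m
    & moved s' m = moved s m].

(* The 2^d vertices of a cell are visited in an arbitrary order. *)
Definition for_corners c (body : vertex d -> state R d M -> state R d M -> Prop)
    (s s' : state R d M) : Prop :=
  exists2 vs, perm_eq vs (corners c) & loop body vs s s'.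

(* Application-specific operations do not act on the state; moves are part of
   EnterCell. *)
Definition pidt (e : event d) (s s' : state R d M) : Prop :=
  match e with
  | TouchFirst v => touch_first v s s'
  | EnterCell c =>
      for_corners c (if refined k T c then drop c else move c) s s'
  | LeaveCell c => for_corners c (reassign c) s s'
  | TouchLast v => lift v s s'
  end.

Definition run (es : seq (event d)) (s s' : state R d M) : Prop :=
  loop pidt es s s'.

Definition initial s : Prop := forall m,
  [/\ assigned s m \in vertices T,
      in_dual (assigned s m) (pos s m)
    & in_domain (pos s m)].

End PIDT.

(* Main.v *)
Require Import Defs.
From mathcomp Require Import all_boot all_order all_algebra.
From mathcomp Require Import finmap.
From mathcomp Require Import reals.
From mathcomp Require Import lra zify.

Import Order.TTheory GRing.Theory Num.Theory.

(** Only a move can take a particle out of the dual cell of its vertex, and it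
    sets the flag of the particle.  A displaced particle is then either
    recaptured by a dual cell when some cell is left, or lifted.  Since every
    vertex below level 0 has a parent and the last touches are bottom-up, all
    displaced particles sit on the corners of the root cell when that cell is
    left; the dual cells of these corners cover the domain, so this event puts
    every particle back into the dual cell of its vertex.  Within one traversal,
    a displaced particle always sits on a vertex that has already been touched
    for the first time. *)

Local Open Scope ring_scope.

(** * Event order, corners of cells, and loops *)

Lemma mem_before {d : nat} {p q : seq (event d)} {e e1 : event d} :
  before (p ++ e :: q) e1 e -> e1 \in p.
Proof.
rewrite /before !index_cat /= eqxx addn0.
case: (boolP (e1 \in p)) => // _; case: (boolP (e \in p)) => [|_]; last by lia.
rewrite -index_mem => ep lt_pe.
by have := ltn_trans (leq_ltn_trans (leq_addr _ _) lt_pe) ep; rewrite ltnn.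
Qed.

Lemma notin_before {d : nat} {p q : seq (event d)} {e e2 : event d} :
  e \notin p -> before (p ++ e :: q) e e2 -> e2 \notin rcons p e.
Proof.
move=> /negbTE ep; rewrite /before !index_cat ep /= eqxx addn0.
case: (boolP (e2 \in p)) => [|e2p].
  by rewrite -index_mem => /ltn_trans/[apply]; rewrite ltnn.
rewrite mem_rcons inE negb_or e2p andbT eq_sym.
by case: eqP => //; rewrite addn0 ltnn.
Qed.

Lemma before_trans {d : nat} {t : seq (event d)} {e1 e2 e3 : event d} :
  before t e1 e2 -> before t e2 e3 -> before t e1 e3.
Proof. exact: ltn_trans. Qed.

Lemma cornersP {d : nat} {c : cell d} {v : vertex d} :
  reflect (v.1 = c.1 /\ exists e : 'I_d -> bool, forall i, v.2 i = (c.2 i + e i)%N)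
          (v \in corners c).
Proof.
apply: (iffP mapP) => [[e _ ->]|[v1 [e ve]]].
  by split=> //; exists e => i; rewrite ffunE.
exists [ffun i => e i]; first by rewrite mem_enum.
case: v v1 ve => l j /= -> ve; congr pair; apply/ffunP => i.
by rewrite ve !ffunE.
Qed.

Lemma verticesP {d : nat} {T : {fset cell d}} {v : vertex d} :
  reflect (exists2 c, c \in T & v \in corners c) (v \in vertices T).
Proof.
rewrite mem_undup; apply: (iffP flatten_mapP) => -[c cT vc]; by exists c.
Qed.

Lemma loop_ind {I : eqType} {S : Type} (body : I -> S -> S -> Prop)
    (vs : seq I) (P : S -> Prop) (s s' : S) :
  (forall v s1 s2, v \in vs -> body v s1 s2 -> P s1 -> P s2) ->
  loop body vs s s' -> P s -> P s'.
Proof.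
elim: vs s => [|v vs IH] s /= stepP; first by move=> ->.
case=> s1 bs ls Ps; apply: IH ls _ => [w s2 s3 wvs|].
  by apply: stepP; rewrite inE wvs orbT.
by apply: stepP bs Ps; rewrite mem_head.
Qed.

Lemma loop_cat {I S : Type} {body : I -> S -> S -> Prop} {xs ys : seq I}
    {s s' : S} :
  loop body (xs ++ ys) s s' ->
  exists2 s1, loop body xs s s1 & loop body ys s1 s'.
Proof.
elim: xs s => [|x xs IH] s /=; first by exists s.
case=> s1 bs /IH[s2 l1 l2]; exists s2 => //; by exists s1.
Qed.

(** * Parents in the spacetree and their consequences for the event order *)

Section Spacetree.
Context {d k : nat} {T : {fset cell d}} (hT : spacetree k T).

Lemma level0_root {c : cell d} : c \in T -> c.1 = 0%N -> c = root_cell d.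
Proof.
by case: hT => _ + _ cT c0 => /(_ _ cT)[//|[b _ /andP[/eqP]]]; rewrite c0.
Qed.

(** Dividing the coordinates of [v] by [k] gives a parent. If [v] is a corner of a child of [b],
    each coordinate lies between [k * b.2 i] and [k * b.2 i + k], so its quotient is [b.2 i] or its
    successor. *)
Lemma parents_neq0 {v : vertex d} : (0 < k)%N ->
  v \in vertices T -> (0 < v.1)%N -> parents k T v != [::].
Proof.
move=> k0 vT v0.
pose w : vertex d := (v.1.-1, [ffun i => (v.2 i %/ k)%N]).
have hasb (a : cell d) : a \in T -> v \in corners a ->
    exists2 b, b \in T & child_of k a b && (w \in corners b).
  case: hT => _ + _ aT va => /(_ _ aT)[aE|[b bT ab]].
    by case/cornersP: va => v1 _; move: v0; rewrite v1 aE.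
  exists b => //; rewrite ab; case/andP: ab => /eqP a1 /forallP ab.
  case/cornersP: va => v1 [e ve]; apply/cornersP.
  split; first by rewrite /= v1 a1.
  exists (fun i => (v.2 i %/ k != b.2 i)%N) => i; rewrite ffunE.
  move: (ab i) (ve i); set B := b.2 i; set A := a.2 i; set V := v.2 i.
  move=> /andP[lo up] ->.
  have lo' : (B <= (A + e i) %/ k)%N by rewrite leq_divRL //; lia.
  have up' : ((A + e i) %/ k < B.+2)%N.
    by rewrite ltn_divLR // !mulSn; case: (e i) => /=; lia.
  by case: eqP => /=; lia.
suff : w \in parents k T v by case: (parents k T v).
rewrite mem_filter; apply/andP; split.
  apply/allP => a aT; apply/implyP => va; apply/hasP.
  by have [b] := hasb _ aT va; exists b.
have [a aT va] := verticesP vT.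
have [b bT /andP[_ wb]] := hasb _ aT va.
by apply/verticesP; exists b.
Qed.

(** Some child [a] of [b] has corner [va], and [b] has corner [vb]; the chain runs through entering
    [b], entering [a] and leaving [a]. So a lift always ends on a vertex already touched. *)
Lemma touch_first_parent {t : seq (event d)} {va vb : vertex d} :
  traversal k T t -> va \in vertices T -> vb \in parents k T va ->
  before t (TouchFirst vb) (TouchLast va).
Proof.
move=> tr /verticesP[a aT va_a]; rewrite mem_filter => /andP[/allP vp _].
have /hasP[b bT /andP[ab vb_b]] := implyP (vp _ aT) va_a.
apply: before_trans (touch_enter tr bT vb_b) _.
apply: before_trans (enter_top_down tr aT bT ab) _.
by apply: before_trans (enter_leave tr aT) (leave_touch tr aT va_a).
Qed.

Lemma enter_leave_root {t : seq (event d)} {c : cell d} :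
  traversal k T t -> c \in T ->
  before t (EnterCell c) (LeaveCell (root_cell d)).
Proof.
move=> tr cT; case: (posnP c.1) => [c0|c0].
  by rewrite -(level0_root cT c0); apply: (enter_leave tr).
(* Cells and vertices are the same pairs: [c] read as a vertex is the lower corner of the cell
   [c]. *)
have cc : c \in corners c.
  by apply/cornersP; split=> //; exists (fun=> false) => i; rewrite addn0.
apply: before_trans (enter_leave tr cT) _.
apply: before_trans (leave_touch tr cT cc) _.
by apply: touch_last_root tr _ _ c0; apply/verticesP; exists c.
Qed.

Lemma notin_prefix {p q : seq (event d)} {e : event d} :
  traversal k T (p ++ e :: q) -> e \notin p.
Proof.
move=> tr; have := each_once tr e; rewrite count_cat /= eqxx => ce.
apply/negP => ep; have : (0 < count_mem e p)%N.
  by rewrite -has_count; apply/hasP; exists e => //=.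
by case: (is_event T e) ce => /=; lia.
Qed.

(** * The invariant and its preservation by each event *)

Context {R : realType} {o : 'rV[R]_d} {h : R} {M : Type}.
Implicit Types (s : state R d M) (m : M).

Lemma root_duals_cover {x : 'rV[R]_d} : in_domain k o h x ->
  has (fun v => in_dual k o h v x) (corners (root_cell d)).
Proof.
move=> /forallP dx; apply/hasP.
(* In each direction, take the face of the root nearer to [x]; on level 0 the mesh size is [h]. *)
exists (0%N, [ffun i => nat_of_bool (o 0 i + h / 2 < x 0 i)]).
  apply/cornersP; split=> //.
  by exists (fun i => o 0 i + h / 2 < x 0 i) => i; rewrite !ffunE.
apply/forallP => i; move: (dx i).
rewrite /= !ffunE /mesh expr0 divr1 ler_norml.
by case: ltP => /= lt_x; lra.
Qed.

(* The invariant that holds after the events p of a traversal. *)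
Definition consistent (p : seq (event d)) s : Prop := forall m,
  [/\ assigned s m \in vertices T,
      in_domain k o h (pos s m)
    & ~~ in_dual k o h (assigned s m) (pos s m) ->
      [/\ moved s m,
          TouchFirst (assigned s m) \in p,
          (0 < (assigned s m).1)%N -> TouchLast (assigned s m) \notin p
        & LeaveCell (root_cell d) \notin p]].

Lemma consistent_nil s : consistent [::] s <-> initial k o h T s.
Proof.
split=> H m; have [? H2 H3] := H m; split=> //; last by rewrite H2.
by apply: contraT => /H3[].
Qed.

Lemma consistent_weaken {p : seq (event d)} {e : event d} {s} :
  (forall v, e <> TouchLast v) -> e <> LeaveCell (root_cell d) ->
  consistent p s -> consistent (rcons p e) s.
Proof.
move=> eT eL H m; have [? ? H3] := H m; split=> // /H3[mv tf tl lr].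
split=> //; rewrite ?mem_rcons ?inE ?tf ?orbT // ?negb_or ?lr ?andbT.
  by move=> /tl ->; rewrite andbT; apply/eqP => /esym /eT.
by apply/eqP => /esym.
Qed.

(** Resetting flags could only harm a displaced particle on [v], but such a particle needs an
    earlier [TouchFirst v], and that event occurs once. *)
Lemma consistent_touch_first {p q : seq (event d)} {v s s'} :
  traversal k T (p ++ TouchFirst v :: q) -> touch_first k T v s s' ->
  consistent p s -> consistent (rcons p (TouchFirst v)) s'.
Proof.
move=> tr st H; apply: consistent_weaken => // m.
have [Ha Hd Hb] := H m; have [-> -> ->] := st m; split=> // /Hb[mv tf tl lr].
split=> //; case: eqP tf => //= ->.
by rewrite (negbTE (notin_prefix tr)).
Qed.

Lemma consistent_drop {p : seq (event d)} {c v s s'} :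
  Defs.drop k o h T c v s s' -> consistent p s -> consistent p s'.
Proof.
move=> st H m; have [Ha Hd Hb] := H m; have [+ -> ->] := st m.
case: ifP => [_ [/hasP[a aT /andP[_ va]] dl]|_ ->//].
by split=> //; [apply/verticesP; exists a | rewrite dl].
Qed.

Lemma consistent_move {p q : seq (event d)} {c v s s'} :
  traversal k T (p ++ EnterCell c :: q) -> c \in T -> v \in corners c ->
  move k o h c v s s' ->
  consistent (rcons p (EnterCell c)) s -> consistent (rcons p (EnterCell c)) s'.
Proof.
move=> tr cT vc st H m; have [Ha Hd Hb] := H m; have [-> +] := st m.
case: ifP => [/and3P[/eqP av _ _] [Hd' ->]|_ [-> ->]//].
have cp := notin_prefix tr.
split=> // _; rewrite av; split=> //.
- by rewrite mem_rcons inE (mem_before (touch_enter tr cT vc)) orbT.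
- move=> _; apply: notin_before cp _.
  by apply: before_trans (enter_leave tr cT) (leave_touch tr cT vc).
- by apply: notin_before cp _; apply: enter_leave_root tr cT.
Qed.

Lemma consistent_reassign {p : seq (event d)} {c v s s'} :
  c \in T -> reassign k o h c v s s' -> consistent p s -> consistent p s'.
Proof.
move=> cT st H m; have [Ha Hd Hb] := H m; have [+ -> ->] := st m.
case: ifP => [_ [va /andP[_ dl]]|_ ->//].
by split=> //; [apply/verticesP; exists c | rewrite dl].
Qed.

Lemma consistent_leave_root {p q : seq (event d)} {s s'} :
  traversal k T (p ++ LeaveCell (root_cell d) :: q) ->
  for_corners (root_cell d) (reassign k o h (root_cell d)) s s' ->
  consistent p s -> initial k o h T s'.
Proof.
move=> tr [vs pvs ls] H.
have rT : root_cell d \in T by case: hT.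
(* While the loop runs, displaced particles sit only on corners still to be visited. A reassigned
   particle lies in its new dual cell, so it may safely land on a visited corner. *)
pose pending (ws : seq (vertex d)) s := forall m,
  [/\ assigned s m \in vertices T, in_domain k o h (pos s m)
    & ~~ in_dual k o h (assigned s m) (pos s m) ->
      moved s m /\ assigned s m \in ws].
have : pending vs s.
  move=> m; have [Ha Hd Hb] := H m; split=> // /Hb[mv _ tl _]; split=> //.
  (* Below level 0 the last touch of the vertex would already have happened, against the invariant;
     on level 0 the vertex is a corner of the root. *)
  rewrite (perm_mem pvs); case: (posnP (assigned s m).1) => [a0|a0].
    have [c cT ac] := verticesP Ha.
    rewrite -(level0_root cT) //.
    by case/cornersP: ac => <-.
  have := mem_before (touch_last_root tr Ha a0).
  by rewrite (negbTE (tl a0)).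
elim: vs s {H pvs} ls => [|v vs IH] s /=.
  move=> -> H m; have [Ha Hd Hb] := H m; split=> //.
  by apply: contraT => /Hb[].
case=> s1 st /IH{}IH H; apply: IH => m.
have [Ha Hd Hb] := H m; have [+ -> ->] := st m.
case: ifP => [_ [va /andP[_ dl]]|nomove ->].
  by split=> //; [apply/verticesP; exists (root_cell d) | rewrite dl].
split=> // nd; have [mv] := Hb nd; rewrite mv inE => /orP[/eqP av|->//].
move: nomove; rewrite av eqxx mv /= => /negP[].
(* The covering corner [w] differs from [v], whose dual cell misses the position; hence the particle
   would have been reassigned. *)
have /hasP[w wr dw] := root_duals_cover Hd.
apply/hasP; exists w => //; rewrite dw andbT.
by apply: contra nd => /eqP wv; rewrite av -wv.
Qed.

(** A lifted particle may still be displaced, but its new vertex has had its first touch and awaits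
    its last. A displaced particle that stays on [v] must be on level 0, where the invariant ignores
    last touches. *)
Lemma consistent_lift {p q : seq (event d)} {v s s'} : (0 < k)%N ->
  traversal k T (p ++ TouchLast v :: q) -> v \in vertices T ->
  Defs.lift k o h T v s s' ->
  consistent p s -> consistent (rcons p (TouchLast v)) s'.
Proof.
move=> k0 tr vT st H m; have [Ha Hd Hb] := H m; have [+ -> ->] := st m.
have vp := notin_prefix tr.
case: ifP => [/and4P[/eqP av mv nd _] vb|nolift ->].
  have vbT : assigned s' m \in vertices T.
    by move: vb; rewrite mem_filter => /andP[].
  split=> // _; split=> //.
  - rewrite mem_rcons inE.
    by rewrite (mem_before (touch_first_parent tr vT vb)) orbT.
  - by move=> _; exact: notin_before vp (touch_last_bottom_up tr vT vb).
  - rewrite mem_rcons inE negb_or; apply/andP; split; first by apply/eqP.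
    by move: nd; rewrite -av => /Hb[].
split=> // nd; have [mv tf tl lr] := Hb nd; split=> //.
- by rewrite mem_rcons inE tf orbT.
- move=> a0; rewrite mem_rcons inE negb_or tl // andbT.
  apply/eqP => -[av]; move: nolift.
  by rewrite -av eqxx mv nd parents_neq0.
- by rewrite mem_rcons inE negb_or lr andbT; apply/eqP.
Qed.

Lemma consistent_event {p q : seq (event d)} {e s s'} : (0 < k)%N ->
  traversal k T (p ++ e :: q) -> pidt k o h T e s s' ->
  consistent p s -> consistent (rcons p e) s'.
Proof.
move=> k0 tr st H.
have eT : is_event T e.
  by have := each_once tr e; rewrite count_cat /= eqxx; case: is_event => //; lia.
case: e => [v|c|c|v] in tr st eT *.
- exact: consistent_touch_first tr st H.
- case: st => vs pvs ls.
  (* The event is recorded before its loop, so that the loop preserves the invariant for one fixed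
     prefix. *)
  have : consistent (rcons p (EnterCell c)) s by apply: consistent_weaken.
  apply: loop_ind ls => w s1 s2; rewrite (perm_mem pvs) => wc.
  by case: ifP => _; [apply: consistent_drop | apply: consistent_move tr eT wc].
- have [cr|cr] := eqVneq c (root_cell d).
    subst c; have S := consistent_leave_root tr st H.
    by move=> m; have [Ha dl Hd] := S m; split=> //; rewrite dl.
  case: st => vs pvs ls.
  have : consistent (rcons p (LeaveCell c)) s.
    by apply: consistent_weaken => // -[] /eqP; rewrite (negbTE cr).
  by apply: loop_ind ls => w s1 s2 _; apply: consistent_reassign.
- exact: consistent_lift k0 tr eT st H.
Qed.

(** * From single events to whole traversals *)

Lemma consistent_run {p q : seq (event d)} {s s'} : (0 < k)%N ->
  traversal k T (p ++ q) -> run k o h T p s s' ->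
  initial k o h T s -> consistent p s'.
Proof.
move=> k0 + + /consistent_nil.
elim/last_ind: p q s' => [|p e IH] q s'; first by move=> _ ->.
rewrite cat_rcons -cats1 => tr /loop_cat[s1 rp /= [s2 st ->]] H.
rewrite cats1; apply: (consistent_event k0 tr st).
by apply: IH tr rp H.
Qed.

(** A complete traversal has left the root cell, so the invariant allows no displaced particle and
    the next traversal starts afresh. *)
Lemma initial_traversal {t : seq (event d)} {s s'} : (0 < k)%N ->
  traversal k T t -> run k o h T t s s' ->
  initial k o h T s -> initial k o h T s'.
Proof.
move=> k0 tr rt S m.
have tr0 : traversal k T (t ++ [::]) by rewrite cats0.
have [Ha Hd Hb] := consistent_run k0 tr0 rt S m; split=> //.
apply: contraT => /Hb[_ _ _ /negP[]].
rewrite -has_pred1 has_count (each_once tr) /=.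
by case: hT => ->.
Qed.

End Spacetree.

Theorem theorem5p2 (R : realType) (d k : nat) (o : 'rV[R]_d) (h : R)
    (T : {fset cell d}) (M : Type)
    (trs : seq (seq (event d))) (t1 t2 : seq (event d)) (v : vertex d)
    (s0 s : state R d M)
    (hd : d = 2%N \/ d = 3%N) (hk : (2 <= k)%N) (hh : 0 < h)
    (hT : spacetree k T)
    (hs0 : initial k o h T s0)
    (htrs : forall t, t \in trs -> traversal k T t)
    (ht : traversal k T (t1 ++ TouchFirst v :: t2))
    (hrun : run k o h T (flatten trs ++ rcons t1 (TouchFirst v)) s0 s) :
  forall m : M, assigned s m = v -> in_dual k o h v (pos s m).
Proof.
have k0 : (0 < k)%N by apply: ltnW.
have [s1 r1] := loop_cat hrun.
have {hs0 r1} S1 : initial k o h T s1.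
  elim: trs s0 hs0 htrs r1 {hrun} => [|t trs IH] s0 hs0 htrs /=.
    by move=> ->.
  move=> /loop_cat[s2 rt ?]; apply: (IH s2) => // [|t' t't]; last first.
    by apply: htrs; rewrite inE t't orbT.
  apply: (initial_traversal hT k0 _ rt hs0).
  by apply: htrs; rewrite mem_head.
rewrite -cats1 => /loop_cat[s2 r2 /= [s3 st ->]] m.
(* The invariant is taken just before the touch, which changes neither assignments nor positions: a
   displaced particle on [v] would put [TouchFirst v] in [t1]. *)
have C := consistent_run hT k0 ht r2 S1.
have [Ha Hd Hb] := C m; have [-> -> _] := st m => av.
apply: contraT; rewrite -av => /Hb[_ + _ _].
by rewrite av (negbTE (notin_prefix ht)).
Qed.
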